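(* Let $(\lambda_k)_{k\ge 1}$ be a nondecreasing sequence of positive real numbers tending to infinity with $\lambda_1=1$ and $\lambda_{k+1}\le\lambda_k+1$ for all $k$, let $p=(p_k)_{k\ge1}$ be a bounded sequence of real numbers with $p_k>1$ for all $k$, and let $H=\sup_k p_k$, $M=\max\{1,H\}$. (a) The space $V(\lambda;p)$ is a complete paranormed space with the paranorm $$h(x)=\left(\sum_{k=1}^{\infty}\left(\frac{1}{\lambda_k}\sum_{j\in I_k}|x_j|\right)^{p_k}\right)^{1/M}.$$ (b) If $p_k=p$ for all $k$, where $1<p<\infty$ is a constant, then $V(\lambda;p)$ reduces to the space $$V_p(\lambda)=\left\{x=(x_j)\in\ell^0:\ \sum_{k=1}^{\infty}\left(\frac{1}{\lambda_k}\sum_{j\in I_k}|x_j|\right)^{p}<\infty\right\},$$ and $V_p(\lambda)$ is a complete normed space with the norm $$\|x\|_{V_p(\lambda)}=\left(\sum_{k=1}^{\infty}\left(\frac{1}{\lambda_k}\sum_{j\in I_k}|x_j|\right)^{p}\right)^{1/p}.$$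
   Context: $\ell^0$ denotes the space of all real sequences $x=(x_j)_{j\ge1}$, with coordinatewise addition and scalar multiplication. For each $k\ge1$, $I_k=[k-\lambda_k+1,k]$, and $j\in I_k$ means that $j$ is a positive integer with $k-\lambda_k+1\le j\le k$. The space $V(\lambda;p)$ is $$V(\lambda;p)=\left\{x=(x_j)\in\ell^0:\ \sum_{k=1}^{\infty}\left(\frac{1}{\lambda_k}\sum_{j\in I_k}|x_j|\right)^{p_k}<\infty\right\}.$$ A paranorm on a real linear space $X$ is a function $h:X\to[0,\infty)$ with $h(0)=0$, $h(-x)=h(x)$, $h(x+y)\le h(x)+h(y)$ for all $x,y\in X$, and such that scalar multiplication is continuous: if $\alpha_n\to\alpha$ in $\mathbb{R}$ and $h(x^n-x)\to0$, then $h(\alpha_n x^n-\alpha x)\to0$. The paranormed space $(X,h)$ is complete if every sequence $(x^n)$ in $X$ that is Cauchy ($h(x^n-x^m)\to0$ as $n,m\to\infty$) converges to some $x\in X$, i.e. $h(x^n-x)\to0$. *)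

(* Defs.v *)
From HB Require Import structures.
From mathcomp Require Import all_boot all_order all_algebra.
From mathcomp Require Import all_classical all_reals all_analysis.

Set Implicit Arguments.
Unset Strict Implicit.
Unset Printing Implicit Defensive.

Import Order.TTheory GRing.Theory Num.Theory.
Import numFieldNormedType.Exports.

Local Open Scope classical_set_scope.
Local Open Scope ring_scope.

(* A real linear space is a linear subspace X of an ambient lmodType E; the
   function h is only constrained on X. *)
Record is_paranorm (R : realType) (E : lmodType R) (X : set E) (h : E -> R) :
    Prop := {
  paranorm_ge0 : forall x, X x -> 0 <= h x ;
  paranorm0 : h 0 = 0 ;
  paranormN : forall x, X x -> h (- x) = h x ;
  paranormD : forall x y, X x -> X y -> h (x + y) <= h x + h y ;
  paranorm_scale_continuous :
    forall (a : nat -> R) (a0 : R) (x : nat -> E) (x0 : E),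
      (forall n, X (x n)) -> X x0 ->
      a n @[n --> \oo] --> a0 ->
      h (x n - x0) @[n --> \oo] --> (0 : R) ->
      h (a n *: x n - a0 *: x0) @[n --> \oo] --> (0 : R)
}.

Definition paranorm_complete (R : realType) (E : lmodType R) (X : set E)
    (h : E -> R) : Prop :=
  forall u : nat -> E, (forall n, X (u n)) ->
    h (u nm.1 - u nm.2) @[nm --> (\oo, \oo)] --> (0 : R) ->
    exists2 l, X l & h (u n - l) @[n --> \oo] --> (0 : R).

Definition complete_paranormed_space (R : realType) (E : lmodType R)
    (X : set E) (h : E -> R) : Prop :=
  [/\ submod_closed [in X], is_paranorm X h & paranorm_complete X h].

(* The subset X of E, with the linear operations of E and the restriction of N
   as norm, is a Banach space: j is the inclusion of X into E. *)
Definition complete_normed_space (R : realType) (E : lmodType R)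
    (X : set E) (N : E -> R) : Prop :=
  exists (B : completeNormedModType R) (j : {linear B -> E}),
    [/\ injective j, range j = X & forall b : B, `|b| = N (j b)].

(* Sequences indexed from 1 are functions on nat with the index shifted by one:
   lam k, p k and x j are lambda_(k+1), p_(k+1) and x_(j+1). *)

(* in_I lam k j says that the positive integer j+1 belongs to I_(k+1). *)
Definition in_I (R : realType) (lam : nat -> R) (k j : nat) : bool :=
  k.+1%:R - lam k + 1 <= (j.+1%:R : R) <= k.+1%:R.

(* in_I lam k j forces j < k.+1, so the sum ranges over all of I_(k+1). *)
Definition avg (R : realType) (lam : nat -> R) (x : nat -> R) (k : nat) : R :=
  (lam k)^-1 * \sum_(j < k.+1 | in_I lam k j) `|x j|.

Definition V (R : realType) (lam p : nat -> R) : set (nat -> R) :=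
  [set x | (\sum_(0 <= k <oo) (avg lam x k `^ p k)%:E < +oo)%E].

Definition V_paranorm (R : realType) (lam p : nat -> R) (M : R)
    (x : nat -> R) : R :=
  fine (\sum_(0 <= k <oo) (avg lam x k `^ p k)%:E)%E `^ M^-1.

Definition Vp (R : realType) (lam : nat -> R) (q : R) : set (nat -> R) :=
  [set x | (\sum_(0 <= k <oo) (avg lam x k `^ q)%:E < +oo)%E].

Definition Vp_norm (R : realType) (lam : nat -> R) (q : R)
    (x : nat -> R) : R :=
  fine (\sum_(0 <= k <oo) (avg lam x k `^ q)%:E)%E `^ q^-1.

(* Main.v *)
Require Import Defs.
From HB Require Import structures.
From mathcomp Require Import all_boot all_order all_algebra.
From mathcomp Require Import all_classical all_reals all_analysis.

(** Write A(x)_k for the average of |x_j| over I_k.  The space V(lambda;p) is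
    the set of x whose averages A(x) lie in the variable exponent sequence
    space l(p), and h(x) is the l(p) paranorm of A(x).  Everything follows from
    four properties of the paranorm (sum_k a_k^(p_k))^(1/M) of a nonnegative
    sequence a, where 1 <= p_k <= M, together with elementary facts about
    averages.

    - Subadditivity ([maddox_normD]): p_k / M <= 1, so t |-> t^(p_k/M) is
      subadditive on nonnegative reals, and Minkowski's inequality in l^M
      applies to the sequences a_k^(p_k/M).  As A(x + y) <= A(x) + A(y)
      termwise, h is subadditive.
    - Scaling ([maddox_normZ], [scale_bound]): because 1 <= p_k <= M, |c|^(p_k)
      is at most (|c| + |c|^(1/M))^M, so h(c x) <= (|c| + |c|^(1/M)) h(x).  The
      factor is continuous in c and vanishes at 0; writing
      a_n x_n - a x = a_n (x_n - x) + (a_n - a) x gives the continuity of the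
      scalar multiplication.
    - Control of coordinates ([maddox_norm_ge_term]): a paranorm at most r <= 1
      forces every term to be at most r.  Since lambda_k >= 1, the index k lies
      in I_k, hence |x_k| <= lambda_k A(x)_k, and a Cauchy sequence of
      V(lambda;p) is Cauchy in each coordinate.
    - Lower semicontinuity ([maddox_norm_fatou]): a bound on the paranorms
      passes to termwise limits, because it is a bound on all partial sums.
      Hence the coordinatewise limit of a Cauchy sequence belongs to the space
      and is its limit for h.

    It is convenient to let the paranorm take the value +oo and to be defined on
    all sequences; the space is then the set where it is finite, and the linear
    and paranorm properties are consequences of extended-real inequalities
    ([fin_norm_is_paranorm], [fin_norm_complete]).

    When p is the constant q, M = q and h is homogeneous, hence a norm.  A
    subspace with a norm complete for sequences is made into a Banach space by
    [complete_normed_subspace]; there completeness for Cauchy filters has to be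
    deduced from completeness for Cauchy sequences. *)

Set Implicit Arguments.
Unset Strict Implicit.
Unset Printing Implicit Defensive.

Import Order.TTheory GRing.Theory Num.Theory.
Import numFieldNormedType.Exports.

Local Open Scope classical_set_scope.
Local Open Scope ring_scope.

(** * Banach spaces from complete normed subspaces *)

(** A Cauchy filter contains a ball of radius 1/(n+1) for every n; the centers
    form a Cauchy sequence because two members of a proper filter meet, and the
    filter converges to the limit of the centers. *)
Lemma cauchy_seq_complete (R : realType) (B : normedModType R) :
  (forall u : nat -> B, cauchy (u @ \oo) -> cvg (u @ \oo)) ->
  forall F : set_system B, ProperFilter F -> cauchy F -> cvg F.
Proof.
move=> Bcvg F FF /cauchyP Fc.
have /choice[u Fu] n : exists x, F (ball x (n.+1%:R^-1 : R)).
  by apply: Fc; rewrite invr_gt0.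
(* The balls around u n and u m share a point, both being members of F. *)
have u_near n m : `|u n - u m| < n.+1%:R^-1 + m.+1%:R^-1.
  have [z []] := filter_ex (filterI (Fu n) (Fu m)).
  rewrite -!ball_normE /= => zn zm.
  rewrite (le_lt_trans (ler_distD z _ _))// ltrD// distrC//.
have /Bcvg /cvg_ex[l ul] : cauchy (u @ \oo).
  apply/cauchy_ballP => e e0; rewrite near_map2.
  near=> n m; rewrite -ball_normE /=.
  rewrite (lt_trans (u_near n m))// (splitr e) ltrD//; [near: n|near: m];
    by apply: near_infty_natSinv_lt (PosNum _); rewrite divr_gt0.
apply/cvg_ex; exists l; apply/cvgrPdist_lt => e e0.
have [n [ln ne]] : exists n, `|l - u n| < e / 2 /\ n.+1%:R^-1 < e / 2.
  near \oo => n; exists n; split; near: n.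
  - by move/cvgrPdist_lt : ul; apply; rewrite divr_gt0.
  - by apply: near_infty_natSinv_lt (PosNum _); rewrite divr_gt0.
apply: filterS (Fu n) => z; rewrite -ball_normE /= => uz.
rewrite (le_lt_trans (ler_distD (u n) _ _))// (splitr e) ltrD//.
exact: lt_trans ne.
Unshelve. all: by end_near. Qed.

(** The hypotheses are bundled so that the carrier type below depends on them:
    the algebraic and topological structures can then be found from the type. *)
Record normed_subspace (R : realType) (E : lmodType R) := NormedSubspace {
  ns_set : set E ;
  ns_norm : E -> R ;
  ns_submod : submod_closed [in ns_set] ;
  ns_normD : forall x y, ns_set x -> ns_set y ->
    ns_norm (x + y) <= ns_norm x + ns_norm y ;
  ns_normZ : forall (c : R) x, ns_set x -> ns_norm (c *: x) = `|c| * ns_norm x ;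
  ns_norm_eq0 : forall x, ns_set x -> ns_norm x = 0 -> x = 0 }.

Definition ns_mem (R : realType) (E : lmodType R) (S : normed_subspace E)
  : {pred E} := [in ns_set S].

HB.instance Definition _ (R : realType) (E : lmodType R)
    (S : normed_subspace E) :=
  GRing.isSubmodClosed.Build R E (ns_mem S) (ns_submod S).

Definition ns_sort (R : realType) (E : lmodType R) (S : normed_subspace E) :=
  {x : E | x \in ns_mem S}.

HB.instance Definition _ (R : realType) (E : lmodType R)
  (S : normed_subspace E) := SubChoice.on (ns_sort S).
HB.instance Definition _ (R : realType) (E : lmodType R)
  (S : normed_subspace E) := [SubChoice_isSubLmodule of ns_sort S by <:].

Lemma ns_sortP (R : realType) (E : lmodType R) (S : normed_subspace E)
  (x : ns_sort S) : ns_set S (val x).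
Proof. exact: set_mem (valP x). Qed.

Lemma ns_val_normD (R : realType) (E : lmodType R) (S : normed_subspace E)
    (x y : ns_sort S) :
  ns_norm S (val (x + y)) <= ns_norm S (val x) + ns_norm S (val y).
Proof. by rewrite raddfD; exact: ns_normD (ns_sortP x) (ns_sortP y). Qed.

Lemma ns_val_normZ (R : realType) (E : lmodType R) (S : normed_subspace E)
    (c : R) (x : ns_sort S) :
  ns_norm S (val (c *: x)) = `|c| * ns_norm S (val x).
Proof. by rewrite linearZ; exact: ns_normZ (ns_sortP x). Qed.

Lemma ns_val_norm_eq0 (R : realType) (E : lmodType R) (S : normed_subspace E)
    (x : ns_sort S) : ns_norm S (val x) = 0 -> x = 0.
Proof.
by move=> /(ns_norm_eq0 (ns_sortP x)) x0; apply: val_inj; rewrite raddf0.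
Qed.

HB.instance Definition _ (R : realType) (E : lmodType R)
  (S : normed_subspace E) :=
  @Lmodule_isNormed.Build R (ns_sort S) (fun x => ns_norm S (val x))
   (@ns_val_normD R E S) (@ns_val_normZ R E S) (@ns_val_norm_eq0 R E S).

(** The restriction of the norm turns the subtype of elements of the subspace
    into a normed module, whose Cauchy sequences are those of the subspace. *)
Lemma complete_normed_subspace (R : realType) (E : lmodType R)
    (S : normed_subspace E) :
  paranorm_complete (ns_set S) (ns_norm S) ->
  complete_normed_space (ns_set S) (ns_norm S).
Proof.
move=> Scomplete.
have Bcomplete : forall F : set_system (ns_sort S),
    ProperFilter F -> cauchy F -> cvg F.
  apply: cauchy_seq_complete => u /cauchy_ballP uc.
  have [|l Sl ul] := Scomplete (fun n => val (u n)) (fun n => ns_sortP (u n)).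
    apply/cvgr0Pnorm_lt => e e0; have := uc _ e0; rewrite near_map2.
    apply: filterS => -[n m] /=; rewrite -ball_normE /=.
    rewrite -(raddfB (\val : ns_sort S -> E)).
    by rewrite (ger0_norm (normr_ge0 (u n - u m))).
  apply/cvg_ex; exists (Sub l (mem_set Sl)); apply/cvgrPdist_lt => e e0.
  move/cvgr0Pnorm_lt : ul => /(_ _ e0); apply: filterS => n.
  rewrite distrC; apply: le_lt_trans.
  by rewrite ler_norm.
pose B : completeNormedModType R := HB.pack (ns_sort S)
  (Uniform_isComplete.Build (ns_sort S) Bcomplete).
exists B, (val : ns_sort S -> E); split; last by [].
- by move=> x y; exact: (@val_inj _ _ (ns_sort S)).
- apply/seteqP; split=> [_ [x _ <-]|x Sx]; first exact: ns_sortP.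
  by exists (Sub x (mem_set Sx)).
Qed.

(** * The paranorm of variable exponent sequence spaces *)

(** A number t of [0, 1] is at most t^r; the two fractions a / (a + b) and
    b / (a + b) lie there and add up to 1. *)
Lemma powRD_le (R : realType) (r a b : R) : 0 < r <= 1 -> 0 <= a -> 0 <= b ->
  (a + b) `^ r <= a `^ r + b `^ r.
Proof.
move=> /andP[r0 r1] a0 b0.
have [->|ab0] := eqVneq (a + b) 0; first by
  rewrite powR0 ?gt_eqF// addr_ge0 ?powR_ge0.
have {}ab0 : 0 < a + b by rewrite lt0r ab0 addr_ge0.
have le_pow (t : R) : 0 <= t <= 1 -> t <= t `^ r.
  case/andP; rewrite le_eqVlt => /predU1P[<-|t0 t1]; first by rewrite powR_ge0.
  by rewrite (le_trans _ (ger_powR _ r1)) ?t0// powRr1// ltW.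
have scale x : 0 <= x -> x `^ r = (x / (a + b)) `^ r * (a + b) `^ r.
  by move=> x0; rewrite -powRM ?divr_ge0 ?(ltW ab0)// divfK// gt_eqF.
rewrite (scale a)// (scale b)// -mulrDl ler_peMl ?powR_ge0//.
have -> : 1 = a / (a + b) + b / (a + b) by rewrite -mulrDl divff// gt_eqF.
by apply: lerD; apply: le_pow;
  rewrite divr_ge0 ?(ltW ab0)//= ler_pdivrMr// mul1r ?lerDl ?lerDr.
Qed.

(** The nonnegativity of u matters when a = 0: [powR] takes the value 1 at
    every negative base, so that the power function is not continuous at 0. *)
Lemma cvg_powR (R : realType) (T : Type) (F : set_system T)
    {FF : ProperFilter F} (u : T -> R) (a r : R) : 0 < r -> (forall t, 0 <= u t) ->
  u t @[t --> F] --> a -> u t `^ r @[t --> F] --> a `^ r.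
Proof.
move=> r0 u0 ua.
have [a_gt0|] := ltP 0 a.
  suff ca : {for a, continuous (fun x : R => x `^ r)}.
    exact: (cvg_comp _ _ ua ca).
  apply: differentiable_continuous; apply/derivable1_diffP.
  by apply: derivable_powR; rewrite in_itv/= a_gt0.
move=> a_le0.
have a_eq0 : a = 0.
  by apply/le_anti; rewrite a_le0 (cvgr_to_ge ua)//; exact: nearW.
rewrite a_eq0 powR0 ?gt_eqF// in ua *.
apply/cvgr0Pnorm_lt => e e0.
have e_pow : e = (e `^ r^-1) `^ r.
  by rewrite -powRrM mulVf ?gt_eqF// powRr1 ?ltW.
move/cvgr0Pnorm_lt : ua => /(_ (e `^ r^-1)); rewrite powR_gt0// => /(_ isT).
apply: filterS => t; rewrite !ger0_norm ?powR_ge0// => ut.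
by rewrite [ltRHS]e_pow gt0_ltr_powR// nnegrE ?powR_ge0.
Qed.

Lemma le_poweR (R : realType) (r : R) (x y : \bar R) :
  0 <= r -> (0 <= x)%E -> (x <= y)%E -> (x `^ r <= y `^ r)%E.
Proof.
move=> r0 x0 xy.
by apply: gt0_ler_poweR => //; rewrite in_itv/= leey ?(le_trans x0) ?x0.
Qed.

Lemma maddox_sum_ge0 (R : realType) (p : nat -> R) (a : nat -> R) :
  (0 <= \sum_(0 <= k <oo) (a k `^ p k)%:E)%E.
Proof. by apply: nneseries_ge0 => k _ _; rewrite lee_fin powR_ge0. Qed.

(** The paranorm of Maddox's sequence space l(p), meant for nonnegative
    sequences a and allowed to be infinite. *)
Definition maddox_norm (R : realType) (p : nat -> R) (M : R) (a : nat -> R)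
  : \bar R := ((\sum_(0 <= k <oo) (a k `^ p k)%:E) `^ M^-1)%E.

Lemma maddox_norm_ge0 (R : realType) (p : nat -> R) (M : R) (a : nat -> R) :
  (0 <= maddox_norm p M a)%E.
Proof. exact: poweR_ge0. Qed.

Lemma le_maddox_norm (R : realType) (p : nat -> R) (M : R) (a b : nat -> R) :
  0 <= M -> (forall k, 0 <= p k) -> (forall k, 0 <= a k <= b k) ->
  (maddox_norm p M a <= maddox_norm p M b)%E.
Proof.
move=> M0 p0 ab.
rewrite le_poweR ?invr_ge0 ?maddox_sum_ge0//.
apply: lee_nneseries => [k _ _|k _]; first by rewrite lee_fin powR_ge0.
have /andP[a0 akb] := ab k.
by rewrite lee_fin ge0_ler_powR ?nnegrE// (le_trans a0).
Qed.

(** Passing to the sequence a_k^(p_k/M) reduces the variable exponent p to the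
    constant exponent M, which makes Minkowski's inequality available. *)
Lemma maddox_norm_Lnorm (R : realType) (p : nat -> R) (M : R) (a : nat -> R) :
  0 < M -> maddox_norm p M a =
  Lnorm counting M%:E (EFin \o (fun k => a k `^ (p k / M))).
Proof.
move=> M0; rewrite Lnorm_counting//; congr (_ `^ _)%E.
apply: eq_eseriesr => k _ /=.
by rewrite ger0_norm ?powR_ge0// -powRrM divfK// gt_eqF.
Qed.

(** The exponents p_k / M are at most 1, so that (a_k + b_k)^(p_k/M) is at most
    the k-th term of a sum to which Minkowski's inequality in l^M applies. *)
Lemma maddox_normD (R : realType) (p : nat -> R) (M : R) (a b : nat -> R) :
  1 <= M -> (forall k, 0 < p k <= M) ->
  (forall k, 0 <= a k) -> (forall k, 0 <= b k) ->
  (maddox_norm p M (a \+ b)%R <= maddox_norm p M a + maddox_norm p M b)%E.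
Proof.
move=> M1 pM a0 b0; have M0 : 0 < M by exact: lt_le_trans M1.
rewrite !maddox_norm_Lnorm//.
apply: le_trans (@minkowski_EFin _ _ _ counting
  (fun k => a k `^ (p k / M)) (fun k => b k `^ (p k / M)) _ _ _ M1) => //.
rewrite !Lnorm_counting// le_poweR ?invr_ge0 ?(ltW M0)//.
  by apply: nneseries_ge0 => k _ _; exact: poweR_ge0.
apply: lee_nneseries => [k _ _|k _ /=]; first exact: poweR_ge0.
rewrite lee_fin ge0_ler_powR ?nnegrE ?(ltW M0)//.
rewrite !ger0_norm ?addr_ge0 ?powR_ge0//.
have /andP[pk0 pkM] := pM k.
by rewrite powRD_le// divr_gt0//= ler_pdivrMr// mul1r.
Qed.

(** The power D^M comes out of every term of the series, hence D out of its
    M-th root; [scale_bound] provides such a D. *)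
Lemma maddox_normZ (R : realType) (p : nat -> R) (M c D : R) (a : nat -> R) :
  0 < M -> 0 <= c -> 0 <= D -> (forall k, c `^ p k <= D `^ M) ->
  (forall k, 0 <= a k) ->
  (maddox_norm p M (fun k => c * a k)%R <= D%:E * maddox_norm p M a)%E.
Proof.
move=> M0 c0 D0 cD a0.
have -> : D%:E = ((D `^ M)%:E `^ M^-1)%E.
  by rewrite poweR_EFin -powRrM divff ?gt_eqF// powRr1.
rewrite -poweRM ?lee_fin ?powR_ge0 ?maddox_sum_ge0//.
rewrite le_poweR ?invr_ge0 ?maddox_sum_ge0 ?(ltW M0)//.
rewrite -nneseriesZl; last by move=> k _; rewrite lee_fin powR_ge0.
apply: lee_nneseries => [k _ _|k _ /=]; first by rewrite lee_fin powR_ge0.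
by rewrite -EFinM lee_fin powRM// ler_wpM2r ?powR_ge0.
Qed.

(** A bound on the paranorm is a bound on finitely many terms at a time, which
    is what makes it stable under termwise limits. *)
Lemma maddox_norm_le_fin (R : realType) (p : nat -> R) (M r : R)
    (a : nat -> R) : 0 < M -> 0 <= r -> (maddox_norm p M a <= r%:E)%E <->
  (forall n, \sum_(0 <= k < n) a k `^ p k <= r `^ M).
Proof.
move=> M0 r0.
have -> : (maddox_norm p M a <= r%:E)%E <->
    (\sum_(0 <= k <oo) (a k `^ p k)%:E <= (r `^ M)%:E)%E.
  have MM : M^-1 * M = 1 by rewrite mulVf// gt_eqF.
  split => [ar|ar].
    rewrite -[leLHS]poweRe1 ?maddox_sum_ge0// -MM poweRrM -poweR_EFin.
    by rewrite le_poweR ?poweR_ge0 ?(ltW M0).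
  have -> : r%:E = ((r `^ M)%:E `^ M^-1)%E.
    by rewrite poweR_EFin -powRrM divff ?gt_eqF// powRr1.
  by rewrite le_poweR ?maddox_sum_ge0 ?invr_ge0 ?(ltW M0).
split => [ar n|ar].
  rewrite -lee_fin -sumEFin; apply: le_trans ar.
  by apply: nneseries_lim_ge => k _ _; rewrite lee_fin powR_ge0.
apply: lime_le => [|].
  by apply: is_cvg_nneseries => k _ _; rewrite lee_fin powR_ge0.
by apply: nearW => n; rewrite sumEFin lee_fin.
Qed.

(** For r <= 1, r^M <= r^(p_k), so that a_k^(p_k) <= r^M gives a_k <= r. *)
Lemma maddox_norm_ge_term (R : realType) (p : nat -> R) (M r : R)
    (a : nat -> R) (k : nat) :
  (forall k, 0 < p k <= M) -> (forall k, 0 <= a k) -> 0 <= r <= 1 ->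
  (maddox_norm p M a <= r%:E)%E -> a k <= r.
Proof.
move=> pM a0 /andP[r0 r1]; have /andP[pk0 pkM] := pM k.
have M0 : 0 < M by exact: lt_le_trans pkM.
move/(maddox_norm_le_fin _ _ M0 r0) => /(_ k.+1); rewrite big_nat_recr//= => ar.
have apr : a k `^ p k <= r `^ p k.
  have [r_eq0|r_neq0] := eqVneq r 0.
    apply: le_trans (_ : r `^ M <= _); last by rewrite r_eq0 !powR0 ?gt_eqF.
    by apply: le_trans ar; rewrite lerDr sumr_ge0// => i _; exact: powR_ge0.
  apply: le_trans (_ : r `^ M <= _); last first.
    by rewrite (ger_powR _ pkM)// lt0r r_neq0 r0.
  by apply: le_trans ar; rewrite lerDr sumr_ge0// => i _; exact: powR_ge0.
rewrite leNgt; apply/negP => /(gt0_ltr_powR pk0).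
by rewrite !nnegrE => /(_ r0 (a0 k)); rewrite ltNge apr.
Qed.

Lemma maddox_norm_fatou (R : realType) (p : nat -> R) (M r : R)
    (T : Type) (F : set_system T) {FF : ProperFilter F}
    (u : T -> nat -> R) (a : nat -> R) :
  0 < M -> (forall k, 0 < p k) -> 0 <= r -> (forall t k, 0 <= u t k) ->
  (forall k, u t k @[t --> F] --> a k) ->
  (\forall t \near F, (maddox_norm p M (u t) <= r%:E)%E) ->
  (maddox_norm p M a <= r%:E)%E.
Proof.
move=> M0 p0 r0 u0 ua ur; apply/maddox_norm_le_fin => // n.
have : \sum_(0 <= k < n) u t k `^ p k @[t --> F] -->
    \sum_(0 <= k < n) a k `^ p k.
  by apply: cvg_big => [|k _]; [exact: add_continuous|exact: cvg_powR].
move/cvgr_to_le; apply.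
by apply: filterS ur => t /(maddox_norm_le_fin _ _ M0 r0).
Qed.

(** * Paranorms from extended-real functions *)

(** A subadditive N that may be infinite, and that multiplication by c
    increases at most by the factor D c, is a paranorm where it is finite if D
    is continuous and vanishes at 0. *)
Section ExtendedNorm.
Variables (R : realType) (E : lmodType R) (N : E -> \bar R) (D : R -> R).
Hypothesis N_ge0 : forall x, (0 <= N x)%E.
Hypothesis N0 : N 0 = 0%E.
Hypothesis NN : forall x, N (- x) = N x.
Hypothesis ND : forall x y, (N (x + y)%R <= N x + N y)%E.
Hypothesis NZ : forall c x, (N (c *: x)%R <= (D c)%:E * N x)%E.
Hypothesis D_ge0 : forall c, 0 <= D c.

Definition fin_dom := [set x | (N x < +oo)%E].
Definition fin_norm x := fine (N x).

Lemma fin_normK x : fin_dom x -> (fin_norm x)%:E = N x.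
Proof. by move=> Xx; rewrite fineK// ge0_fin_numE. Qed.

Lemma fin_norm_ge0 x : 0 <= fin_norm x.
Proof. exact: fine_ge0. Qed.

Lemma fin_domD x y : fin_dom x -> fin_dom y -> fin_dom (x + y).
Proof.
by move=> Xx Xy; apply: le_lt_trans (ND x y) _; exact: lte_add_pinfty.
Qed.

Lemma fin_domZ c x : fin_dom x -> fin_dom (c *: x).
Proof.
move=> Xx; apply: le_lt_trans (NZ c x) _.
by apply: lte_mul_pinfty; rewrite ?lee_fin.
Qed.

Lemma fin_domB x y : fin_dom x -> fin_dom y -> fin_dom (x - y).
Proof.
by move=> Xx Xy; apply: fin_domD => //; rewrite -scaleN1r; exact: fin_domZ.
Qed.

Lemma fin_dom_submod_closed : submod_closed [in fin_dom].
Proof.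
split; first by apply: mem_set; rewrite /fin_dom/= N0.
move=> c x y /set_mem Xx /set_mem Xy.
by apply/mem_set/fin_domD => //; exact: fin_domZ.
Qed.

Lemma fin_normD x y : fin_dom x -> fin_dom y ->
  fin_norm (x + y) <= fin_norm x + fin_norm y.
Proof.
move=> Xx Xy; rewrite -lee_fin EFinD !fin_normK//.
exact: fin_domD.
Qed.

Lemma fin_normZ c x : fin_dom x -> fin_norm (c *: x) <= D c * fin_norm x.
Proof.
move=> Xx; rewrite -lee_fin EFinM !fin_normK//.
exact: fin_domZ.
Qed.

Lemma fin_norm_is_paranorm : D 0 = 0 -> continuous D ->
  is_paranorm fin_dom fin_norm.
Proof.
move=> D0 Dcont; split.
- by move=> x _; exact: fin_norm_ge0.
- by rewrite /fin_norm N0.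
- by move=> x _; rewrite /fin_norm NN.
- exact: fin_normD.
move=> a a0 x x0 Xx Xx0 aa0 xx0.
have bound n : fin_norm (a n *: x n - a0 *: x0) <=
    D (a n) * fin_norm (x n - x0) + D (a n - a0) * fin_norm x0.
  have -> : a n *: x n - a0 *: x0 = a n *: (x n - x0) + (a n - a0) *: x0.
    by rewrite scalerBr scalerBl addrA subrK.
  apply: le_trans (fin_normD _ _) _.
  - by apply/fin_domZ/fin_domB.
  - exact: fin_domZ.
  by rewrite lerD// fin_normZ//; exact: fin_domB.
apply: (@squeeze_cvgr _ _ _ _ (fun=> 0)
  (fun n => D (a n) * fin_norm (x n - x0) + D (a n - a0) * fin_norm x0)).
- by apply: nearW => n; rewrite fin_norm_ge0 bound.
- exact: cvg_cst.
have -> : 0 = D a0 * 0 + D 0 * fin_norm x0 by rewrite D0 mulr0 mul0r addr0.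
apply: cvgD; first by apply: cvgM => //; exact: (cvg_comp _ _ aa0 (Dcont a0)).
apply: cvgMl.
have a0_0 : a n - a0 @[n --> \oo] --> (0 : R).
  by rewrite -(subrr a0); apply: cvgB => //; exact: cvg_cst.
exact: (cvg_comp _ _ a0_0 (Dcont 0)).
Qed.
End ExtendedNorm.

(** Completeness of a space of sequences from two properties of N: smallness of
    N x controls the coordinates of x, which provides a coordinatewise limit l
    of a Cauchy sequence u, and N is lower semicontinuous for coordinatewise
    convergence, which bounds N (u n - l) when m tends to infinity in
    N (u n - u m). *)
Lemma fin_norm_complete (R : realType) (N : (nat -> R) -> \bar R)
    (C : nat -> R) :
  (forall x, 0 <= N x)%E ->
  (forall x y, fin_dom N x -> fin_dom N y -> fin_dom N (x - y)) ->
  (forall k, 0 < C k) ->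
  (forall r x k, 0 <= r <= 1 -> (N x <= r%:E)%E -> `|x k| <= C k * r) ->
  (forall r (u : nat -> nat -> R) l, 0 <= r ->
    (forall k, u m k @[m --> \oo] --> l k) ->
    (\forall m \near \oo, (N (u m) <= r%:E)%E) -> (N l <= r%:E)%E) ->
  paranorm_complete (fin_dom N) (fin_norm N).
Proof.
move=> N_ge0 XB C0 coord fatou u Xu /cvgr0Pnorm_le uc.
have u_near e : 0 < e -> \forall n & m \near \oo, (N (u n - u m)%R <= e%:E)%E.
  move=> /uc; apply: filterS => -[n m] /=; rewrite ger0_norm ?fin_norm_ge0//.
  by rewrite -lee_fin fin_normK//; exact: XB.
have /choice[l ul] j : exists l, u n j @[n --> \oo] --> (l : R).
  apply/cvg_ex/cauchy_cvgP/cauchy_ballP => e e0; rewrite near_map2.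
  (* The coordinates are controlled by N only below 1. *)
  have d0 : 0 < Num.min 1 (e / 2 / C j) by rewrite lt_min ltr01 !divr_gt0.
  apply: filterS (u_near _ d0) => -[n m] /= ud.
  rewrite -ball_normE /=; have -> : u n j - u m j = (u n - u m) j by [].
  apply: le_lt_trans (coord _ _ j _ ud) _; first by rewrite ltW//= ge_min lexx.
  apply: le_lt_trans (_ : C j * (e / 2 / C j) < _).
    by rewrite ler_wpM2l ?(ltW (C0 j))// ge_min lexx orbT.
  by rewrite mulrC divfK ?gt_eqF// ltr_pdivrMr// ltr_pMr// ltr1n.
have ul_near e : 0 < e -> \forall n \near \oo, (N (u n - l)%R <= e%:E)%E.
  move=> e0; have /nearP_dep := u_near e e0; apply: filterS => n un.
  apply: (fatou _ (fun m => u n - u m)) un; first exact: ltW.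
  by move=> k; apply: cvgB; [exact: cvg_cst|exact: ul].
have Xul e n : (N (u n - l)%R <= e%:E)%E -> fin_dom N (u n - l).
  by move=> ue; apply: le_lt_trans ue (ltry _).
exists l.
  have [n /Xul un] := filter_ex (ul_near 1 ltr01).
  by rewrite -(subKr (u n) l); exact: XB.
apply/cvgr0Pnorm_le => e e0; apply: filterS (ul_near e e0) => n une.
by rewrite ger0_norm ?fin_norm_ge0// -lee_fin fin_normK//; exact: Xul une.
Qed.

(** * Averages over the intervals I_k *)

Lemma avg_ge0 (R : realType) (lam x : nat -> R) (k : nat) :
  0 <= lam k -> 0 <= avg lam x k.
Proof. by move=> lam0; rewrite mulr_ge0 ?invr_ge0// sumr_ge0. Qed.

Lemma avgD_le (R : realType) (lam x y : nat -> R) (k : nat) :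
  0 <= lam k -> avg lam (x + y) k <= avg lam x k + avg lam y k.
Proof.
move=> lam0; rewrite -mulrDr -big_split ler_wpM2l ?invr_ge0//.
by apply: ler_sum => j _; exact: ler_normD.
Qed.

Lemma avgZ (R : realType) (lam x : nat -> R) (c : R) :
  avg lam (c *: x) = (fun k => `|c| * avg lam x k).
Proof.
apply/funext => k; rewrite /avg [in RHS]mulrCA [X in _ = _ * X]mulr_sumr.
congr (_ * _).
by apply: eq_bigr => j _; rewrite -normrM.
Qed.

Lemma avg0 (R : realType) (lam : nat -> R) : avg lam 0 = (fun=> 0).
Proof.
by apply/funext => k; rewrite /avg big1 ?mulr0// => j _; rewrite normr0.
Qed.

(** The positive integer k + 1 belongs to its own interval I_(k+1) as soon as
    lambda_(k+1) >= 1. *)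
Lemma le_avg (R : realType) (lam x : nat -> R) (k : nat) :
  1 <= lam k -> `|x k| <= lam k * avg lam x k.
Proof.
move=> lam1; have lam0 : 0 < lam k by exact: lt_le_trans lam1.
have kI : in_I lam k k by rewrite /in_I lexx andbT -addrA gerDl addrC subr_le0.
rewrite /avg mulVKf ?gt_eqF//.
by rewrite (bigD1 (ord_max : 'I_k.+1))//= lerDl sumr_ge0.
Qed.

Lemma cvg_avg (R : realType) (T : Type) (F : set_system T) {FF : Filter F}
    (lam : nat -> R) (u : T -> nat -> R) (x : nat -> R) (k : nat) :
  (forall j, u t j @[t --> F] --> x j) ->
  avg lam (u t) k @[t --> F] --> avg lam x k.
Proof.
move=> ux; apply: cvgMr.
by apply: cvg_big => [|j _]; [exact: add_continuous|exact: cvg_norm].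
Qed.

(** * The spaces V(lambda;p) and V_p(lambda) *)

(** The paranorm of V(lambda;p) extended to all sequences by the value +oo. *)
Definition xV_norm (R : realType) (lam p : nat -> R) (M : R) (x : nat -> R) :=
  maddox_norm p M (avg lam x).

Lemma V_fin_dom (R : realType) (lam p : nat -> R) (M : R) :
  0 < M -> V lam p = fin_dom (xV_norm lam p M).
Proof.
move=> M0; apply/seteqP; split=> x; first exact: poweR_lty.
by apply: lty_poweRy; rewrite invr_eq0 gt_eqF.
Qed.

Lemma V_paranorm_fin_norm (R : realType) (lam p : nat -> R) (M : R) :
  V_paranorm lam p M = fin_norm (xV_norm lam p M).
Proof.
by apply/funext => x; rewrite /fin_norm /xV_norm /maddox_norm fine_poweR.
Qed.

Lemma xV_normN (R : realType) (lam p : nat -> R) (M : R) (x : nat -> R) :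
  xV_norm lam p M (- x) = xV_norm lam p M x.
Proof.
congr maddox_norm; rewrite -scaleN1r avgZ normrN1.
by apply/funext => k; rewrite mul1r.
Qed.

Lemma xV_normD (R : realType) (lam p : nat -> R) (M : R) (x y : nat -> R) :
  (forall k, 1 <= lam k) -> (forall k, 1 <= p k <= M) ->
  (xV_norm lam p M (x + y)%R <= xV_norm lam p M x + xV_norm lam p M y)%E.
Proof.
move=> lam1 pM.
have M1 : 1 <= M by have /andP[p0 /(le_trans p0)] := pM 0%N.
have lam0 k : 0 <= lam k by exact: le_trans (lam1 k).
have p0 k : 0 < p k <= M.
  by have /andP[p1 ->] := pM k; rewrite (lt_le_trans _ p1).
have a0 z k : 0 <= avg lam z k by exact: avg_ge0.
apply: le_trans (maddox_normD M1 p0 (a0 x) (a0 y)).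
apply: le_maddox_norm => [|k|k]; first exact: le_trans M1.
  by have /andP[/ltW] := p0 k.
by rewrite a0 avgD_le.
Qed.

Lemma xV_normZ (R : realType) (lam p : nat -> R) (M c D : R) (x : nat -> R) :
  0 < M -> 0 <= D -> (forall k, 0 <= lam k) ->
  (forall k, `|c| `^ p k <= D `^ M) ->
  (xV_norm lam p M (c *: x)%R <= D%:E * xV_norm lam p M x)%E.
Proof.
move=> M0 D0 lam0 cD; rewrite /xV_norm avgZ maddox_normZ// => k.
exact: avg_ge0.
Qed.

(** If |c| >= 1 then |c|^q <= |c|^M, and if |c| <= 1 then
    |c|^q <= |c| = (|c|^(1/M))^M; the sum of the two bases serves both cases. *)
Lemma scale_bound (R : realType) (c q M : R) : 1 <= q <= M ->
  `|c| `^ q <= (`|c| + `|c| `^ M^-1) `^ M.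
Proof.
move=> /andP[q1 qM].
have M0 : 0 < M by rewrite (lt_le_trans _ (le_trans q1 qM)).
have [c1|c1] := leP 1 `|c|.
  apply: le_trans (_ : `|c| `^ M <= _); first exact: ler_powR.
  rewrite ge0_ler_powR ?nnegrE ?(ltW M0) ?addr_ge0 ?powR_ge0//.
  by rewrite lerDl powR_ge0.
apply: le_trans (_ : (`|c| `^ M^-1) `^ M <= _).
  rewrite -powRrM mulVf ?gt_eqF//.
  have [->|c0] := eqVneq c 0.
    by rewrite normr0 !powR0 ?gt_eqF// (lt_le_trans _ q1).
  by rewrite (ger_powR _ q1)// normr_gt0 c0 ltW.
by rewrite ge0_ler_powR ?nnegrE ?(ltW M0) ?addr_ge0 ?powR_ge0// lerDr.
Qed.

Lemma xV_norm0 (R : realType) (lam p : nat -> R) (M : R) :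
  0 < M -> (forall k, 0 < p k) -> xV_norm lam p M 0 = 0%E.
Proof.
move=> M0 p0; apply/eqP; rewrite eq_le maddox_norm_ge0 andbT.
apply/maddox_norm_le_fin => // n.
by rewrite avg0 powR0 ?gt_eqF// big1// => k _; rewrite powR0// gt_eqF.
Qed.

Lemma xV_norm_coord (R : realType) (lam p : nat -> R) (M r : R) (x : nat -> R)
    (k : nat) :
  (forall k, 1 <= lam k) -> (forall k, 0 < p k <= M) -> 0 <= r <= 1 ->
  (xV_norm lam p M x <= r%:E)%E -> `|x k| <= lam k * r.
Proof.
move=> lam1 p0 r01 xr; have lam0 j : 0 <= lam j by exact: le_trans (lam1 j).
apply: le_trans (le_avg _ (lam1 k)) _; rewrite ler_wpM2l//.
by apply: (maddox_norm_ge_term k p0 _ r01 xr) => j; exact: avg_ge0.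
Qed.

Lemma xV_norm_fatou (R : realType) (lam p : nat -> R) (M r : R)
    (u : nat -> nat -> R) (l : nat -> R) :
  (forall k, 0 <= lam k) -> 0 < M -> (forall k, 0 < p k) -> 0 <= r ->
  (forall k, u m k @[m --> \oo] --> l k) ->
  (\forall m \near \oo, (xV_norm lam p M (u m) <= r%:E)%E) ->
  (xV_norm lam p M l <= r%:E)%E.
Proof.
move=> lam0 M0 p0 r0 ul; apply: maddox_norm_fatou => // [m k|k].
- exact: avg_ge0.
- exact: cvg_avg.
Qed.

Lemma continuous_scale_bound (R : realType) (M : R) : 0 < M ->
  continuous (fun c : R => `|c| + `|c| `^ M^-1).
Proof.
move=> M0 c; have nc : `|x| @[x --> c] --> `|c| by exact: norm_continuous.
apply: (cvgD nc); apply: cvg_powR => //; by rewrite invr_gt0.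
Qed.

Section V.
Variables (R : realType) (lam p : nat -> R) (M : R).
Hypothesis lam1 : forall k, 1 <= lam k.
Hypothesis pM : forall k, 1 <= p k <= M.

Let M0 : 0 < M.
Proof. by have /andP[p1 /(le_trans p1)] := pM 0%N; exact: lt_le_trans. Qed.

Let lam0 k : 0 <= lam k. Proof. exact: le_trans (lam1 k). Qed.

Let pM0 k : 0 < p k <= M.
Proof. by have /andP[p1 ->] := pM k; rewrite (lt_le_trans _ p1). Qed.

Let p0 k : 0 < p k. Proof. by have /andP[] := pM0 k. Qed.

Let D (c : R) := `|c| + `|c| `^ M^-1.

Let D_ge0 c : 0 <= D c. Proof. by rewrite addr_ge0 ?powR_ge0. Qed.

Let N := xV_norm lam p M.

Let N_ge0 x : (0 <= N x)%E. Proof. exact: maddox_norm_ge0. Qed.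

Let ND x y : (N (x + y)%R <= N x + N y)%E. Proof. exact: xV_normD. Qed.

Let NZ c x : (N (c *: x)%R <= (D c)%:E * N x)%E.
Proof. by apply: xV_normZ => // k; exact: scale_bound. Qed.

Lemma V_submod_closed : submod_closed [in V lam p].
Proof.
rewrite (V_fin_dom _ _ M0); apply: fin_dom_submod_closed ND NZ D_ge0.
exact: xV_norm0.
Qed.

Lemma V_is_paranorm : is_paranorm (V lam p) (V_paranorm lam p M).
Proof.
rewrite (V_fin_dom _ _ M0) V_paranorm_fin_norm.
apply: (fin_norm_is_paranorm N_ge0 _ _ ND NZ D_ge0).
- exact: xV_norm0.
- exact: xV_normN.
- by rewrite /D normr0 powR0 ?addr0// invr_eq0 gt_eqF.
- exact: continuous_scale_bound.
Qed.

Lemma V_paranorm_complete : paranorm_complete (V lam p) (V_paranorm lam p M).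
Proof.
rewrite (V_fin_dom _ _ M0) V_paranorm_fin_norm.
apply: (@fin_norm_complete _ _ lam).
- exact: N_ge0.
- exact: fin_domB ND NZ D_ge0.
- by move=> k; exact: lt_le_trans (lam1 k).
- by move=> r x k; exact: xV_norm_coord.
- by move=> r u l; exact: xV_norm_fatou.
Qed.

Lemma V_complete_paranormed_space :
  complete_paranormed_space (V lam p) (V_paranorm lam p M).
Proof.
split; [exact: V_submod_closed|exact: V_is_paranorm|exact: V_paranorm_complete].
Qed.

Lemma V_paranorm_eq0 x : V lam p x -> V_paranorm lam p M x = 0 -> x = 0.
Proof.
rewrite (V_fin_dom _ _ M0) V_paranorm_fin_norm => Vx hx0.
apply/funext => k; apply/eqP; rewrite -normr_le0 -(mulr0 (lam k)).
apply: (xV_norm_coord _ lam1 pM0); first by rewrite lexx ler01.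
by rewrite -[xV_norm _ _ _ _](fin_normK N_ge0 Vx) hx0.
Qed.
End V.

Lemma Vp_norm_homogeneous (R : realType) (lam : nat -> R) (q c : R)
    (x : nat -> R) :
  0 < q -> (forall k, 0 <= lam k) -> Vp lam q x ->
  Vp_norm lam q (c *: x) = `|c| * Vp_norm lam q x.
Proof.
move=> q0 lam0 Vx; rewrite /Vp_norm avgZ.
have -> : (\sum_(0 <= k <oo) ((`|c| * avg lam x k) `^ q)%:E)%E =
    ((`|c| `^ q)%:E * \sum_(0 <= k <oo) (avg lam x k `^ q)%:E)%E.
  rewrite -nneseriesZl; last by move=> k _; rewrite lee_fin powR_ge0.
  by apply: eq_eseriesr => k _; rewrite powRM ?avg_ge0.
rewrite fineM//; last by rewrite ge0_fin_numE// maddox_sum_ge0.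
rewrite powRM ?powR_ge0//; last by rewrite fine_ge0// maddox_sum_ge0.
by rewrite -powRrM mulfV ?gt_eqF// powRr1.
Qed.

Lemma Vp_complete_normed_space (R : realType) (lam : nat -> R) (q : R) :
  1 <= q -> (forall k, 1 <= lam k) ->
  complete_normed_space (Vp lam q) (Vp_norm lam q).
Proof.
move=> q1 lam1; have qq (k : nat) : 1 <= q <= q by rewrite q1 lexx.
have q0 : 0 < q by exact: lt_le_trans q1.
have lam0 k : 0 <= lam k by exact: le_trans (lam1 k).
have NZ c x : Vp lam q x -> Vp_norm lam q (c *: x) = `|c| * Vp_norm lam q x.
  exact: Vp_norm_homogeneous.
have ND := paranormD (V_is_paranorm lam1 qq).
pose S := NormedSubspace (V_submod_closed lam1 qq) ND NZ
  (V_paranorm_eq0 lam1 qq).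
exact: (@complete_normed_subspace _ _ S (V_paranorm_complete lam1 qq)).
Qed.

Theorem theorem3p1 (R : realType) (lam p : nat -> R)
    (lam_nd : nondecreasing_seq lam)
    (lam_gt0 : forall k, 0 < lam k)
    (lam_oo : lam k @[k --> \oo] --> +oo)
    (lam1 : lam 0%N = 1)
    (lam_step : forall k, lam k.+1 <= lam k + 1)
    (p_bounded : bounded_fun p)
    (p_gt1 : forall k, 1 < p k) :
  let H := sup (range p) in
  let M := Num.max 1 H in
  complete_paranormed_space (V lam p) (V_paranorm lam p M) /\
  (forall q : R, 1 < q -> (forall k, p k = q) ->
     V lam p = Vp lam q /\
     complete_normed_space (Vp lam q) (Vp_norm lam q)).
Proof.
move=> H M.
have lam_ge1 k : 1 <= lam k by rewrite -lam1; exact: lam_nd.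
have p_has_sup : has_sup (range p).
  split; first by exists (p 0%N), 0%N.
  (* [bounded_fun] bounds p by every number strictly above b. *)
  have [b [_ pb]] := p_bounded; exists (b + 1) => _ [k _ <-].
  by apply: le_trans (ler_norm _) _; apply: (pb (b + 1)) => //; rewrite ltrDl.
have pM k : 1 <= p k <= M.
  rewrite ltW//= /M le_max; apply/orP; right.
  by apply: sup_upper_bound => //; exists k.
split; first exact: V_complete_paranormed_space.
move=> q q1 pq; split; last by apply: Vp_complete_normed_space; rewrite ?ltW.
by have -> : p = (fun=> q) by apply/funext.
Qed.
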